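(* Let $p$ be a prime, let $c \geq 1$ be an integer, and let $G$ be a finite $p$-group of order $p^n$. Suppose that $|M^{(c)}(G)| = p^{\chi_{c+1}(n)}$. Let $\theta : M^{(c)}(G) \to M^{(c)}(G/G')$ be the natural homomorphism, i.e. the left-hand map of Fröhlich's five-term sequence for the extension $1 \to G' \to G \to G/G' \to 1$ and the variety of nilpotent groups of class at most $c$. Then: (i) $\theta$ is an epimorphism. (ii) If $\ker\theta = 1$, then $G$ is an elementary abelian $p$-group.
   Context: $G'$ denotes the commutator subgroup of $G$. For a group $G$ with a free presentation $1 \to R \to F \to G \to 1$ ($F$ free, $R$ normal in $F$), the $c$-nilpotent multiplier of $G$ is the abelian group $$M^{(c)}(G) = \frac{R \cap \gamma_{c+1}(F)}{[R,\,_cF]},$$ where $\gamma_{c+1}(F)$ is the $(c+1)$st term of the lower central series of $F$ (with $\gamma_1(F)=F$), $[R,\,_1F]=[R,F]$ and $[R,\,_cF]=[[R,\,_{c-1}F],F]$ for $c \geq 2$. Up to isomorphism it does not depend on the choice of the free presentation. (For $c=1$ it is the Schur multiplier $M(G)$.) $\chi_{c+1}(d)$ denotes the number of basic commutators of weight $c+1$ on $d$ letters; it is given by the Witt formula $\chi_m(d) = \frac{1}{m}\sum_{k \mid m} \mu(k)\, d^{m/k}$, where $\mu$ is the Möbius function. The map $\theta$: for an extension $1 \to N \to G \to Q \to 1$, write $G = F/R$ and $Q = F/S$ with $F$ free and $R \leq S$ (so $N = S/R$). The natural map $\theta : M^{(c)}(G) \to M^{(c)}(Q)$ is the homomorphism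 $$\frac{R \cap \gamma_{c+1}(F)}{[R,\,_cF]} \to \frac{S \cap \gamma_{c+1}(F)}{[S,\,_cF]}$$ induced by the inclusion $R \leq S$. When $N$ is contained in the $c$-th term of the upper central series of $G$, it is the left-hand map of Fröhlich's five-term exact sequence $M^{(c)}(G) \xrightarrow{\theta} M^{(c)}(Q) \to N \to G/\gamma_{c+1}(G) \to Q/\gamma_{c+1}(Q) \to 1$. In the theorem, $N = G'$ and $Q = G/G'$, so $S = RF'$. *)

(* Defs.v *)
From HB Require Import structures.
From mathcomp Require Import all_boot all_fingroup all_solvable.
From mathcomp Require Import generic_quotient.
From mathcomp Require Import boolp.

Set Implicit Arguments.
Unset Strict Implicit.
Unset Printing Implicit Defensive.

Import GroupScope.

Local Open Scope group_scope.
Local Open Scope quotient_scope.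

(* Subgroups of a possibly infinite [groupType] are boolean predicates: the   *)
(* notions of fingroup.v ({group gT}, [~: A, B], G^`(1)) only exist for       *)
(* finite groups.                                                             *)

(* Homomorphisms of such groups; {morphism D >-> rT} is for finite groups.    *)
Notation ghom := UMagmaMorphism.type.

Section Subgroups.
Variable F : groupType.
Implicit Types A B H : {pred F}.

Definition gen A : {pred F} := [pred x |
  `[< forall H : {pred F}, group_closed H -> {subset A <= H} -> x \in H >]].

Definition commsub A B : {pred F} :=
  gen [pred z | `[< exists x y, [/\ x \in A, y \in B & z = [~ x, y]] >]].

(* [rcomm A B k] is [A, _k B] = [[..[A, B], ..], B], with k copies of B. *)
Definition rcomm A B (k : nat) : {pred F} := iter k (fun H => commsub H B) A.

(* gamma_1 = F and gamma_{k+1} = [gamma_k, F]; the index 0 is not used. *)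
Definition gamma (k : nat) : {pred F} := rcomm predT predT k.-1.

Definition conj_closed A := forall x y, x \in A -> x ^ y \in A.

Lemma gen_closed A : group_closed (gen A).
Proof.
split=> [|x y /asboolP xA /asboolP yA]; apply/asboolP => H clH AH.
  by have [] := clH.
by have [_ ->] := clH; [| apply: xA | apply: yA].
Qed.

Lemma mem_gen A x : x \in A -> x \in gen A.
Proof. by move=> xA; apply/asboolP => H _; apply. Qed.

Lemma gen_conj A : conj_closed A -> conj_closed (gen A).
Proof.
move=> cA x y /asboolP xA; apply: (xA [pred z | z ^ y \in gen A]) => [|z zA].
  have [g1 gF] := gen_closed A; split=> [|u v uA vA]; rewrite -topredE /=.
    by rewrite conj1g.
  by rewrite conjMg conjVg; apply: gF.
by rewrite -topredE /=; apply/mem_gen/cA.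
Qed.

Lemma rcomm_closed A B k : group_closed A -> group_closed (rcomm A B k).
Proof. by case: k => [|k] // _; apply: gen_closed. Qed.

Lemma rcomm_conj A B k : conj_closed A -> conj_closed B ->
  conj_closed (rcomm A B k).
Proof.
move=> cA cB; elim: k => [|k cH] //=; apply: gen_conj => w z.
move=> /asboolP[x [y [xH yB ->]]]; apply/asboolP.
by exists (x ^ z), (y ^ z); rewrite conjRg; split=> //; [apply: cH | apply: cB].
Qed.

Lemma sub_rcomm A A' B k : {subset A <= A'} ->
  {subset rcomm A B k <= rcomm A' B k}.
Proof.
move=> sAA'; elim: k => [|k sH] //= x /asboolP xA; apply: xA.
  exact: gen_closed.
move=> _ /asboolP[u [v [uH vB ->]]]; apply/mem_gen/asboolP.
by exists u, v; split=> //; apply: sH.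
Qed.

Lemma gamma_closed k : group_closed (gamma k).
Proof. by apply: rcomm_closed; split. Qed.

End Subgroups.

Section Kernel.
Variables (F G : groupType) (f : ghom F G).

Definition kerg : {pred F} := [pred x | f x == 1].

Lemma kerg_closed : group_closed kerg.
Proof.
split=> [|x y /eqP fx /eqP fy]; first by rewrite inE gmulf1.
by rewrite inE gmulfF fx fy divg1.
Qed.

Lemma kerg_conj : conj_closed kerg.
Proof. by move=> x y /eqP fx; rewrite inE gmulfJ fx conj1g. Qed.

End Kernel.

Section QuotientGroup.
Variable T : groupType.

Record normal_sub := NormalSub {
  ns_pred :> {pred T};
  ns_closed : group_closed ns_pred;
  ns_conj : conj_closed ns_pred }.

Variable N : normal_sub.

Definition coset_eq : rel T := fun x y => x^-1 * y \in ns_pred N.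

Lemma coset_eqP : equiv_class_of coset_eq.
Proof.
have [N1 NF] := ns_closed N; have NV := group_closedV (ns_closed N).
have NM := group_closedM (ns_closed N).
have sym x y : coset_eq x y -> coset_eq y x.
  by rewrite /coset_eq => /NV; rewrite invgM invgK.
split=> [x|x y|y x z]; first by rewrite /coset_eq mulVg.
  by apply/idP/idP; apply: sym.
by rewrite /coset_eq => /NM H /H; rewrite mulgA mulgK.
Qed.

Canonical coset_equiv := EquivRelPack coset_eqP.

Definition quot_group := {eq_quot coset_equiv}.

HB.instance Definition _ := Choice.on quot_group.
HB.instance Definition _ := EqQuotient.on quot_group.

Lemma quot_eqP (x y : T) :
  reflect (\pi_quot_group x = \pi_quot_group y) (x^-1 * y \in ns_pred N).
Proof. exact: eqmodP. Qed.

Definition quot_mul (x y : quot_group) : quot_group :=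
  \pi_quot_group (repr x * repr y).
Definition quot_inv (x : quot_group) : quot_group :=
  \pi_quot_group (repr x)^-1.

Lemma repr_quot (x : T) : x^-1 * repr (\pi_quot_group x) \in ns_pred N.
Proof. by apply/quot_eqP; rewrite reprK. Qed.

Lemma quot_mulE x y :
  quot_mul (\pi_quot_group x) (\pi_quot_group y) = \pi_quot_group (x * y).
Proof.
apply/esym/quot_eqP; have [Nx Ny] := (repr_quot x, repr_quot y).
move: (repr _) (repr _) Nx Ny => a b Nx Ny.
have ->: (x * y)^-1 * (b * a) = (x^-1 * b) ^ y * (y^-1 * a).
  by rewrite /conjg invgM !mulgA mulgK.
by apply: (group_closedM (ns_closed N)) => //; apply: ns_conj.
Qed.

Lemma quot_invE x : quot_inv (\pi_quot_group x) = \pi_quot_group x^-1.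
Proof.
apply/esym/quot_eqP; have := repr_quot x; move: (repr _) => b Nx.
rewrite invgK; have ->: x * b^-1 = (x^-1 * b)^-1 ^ x^-1.
  by rewrite /conjg invgM !invgK mulgK.
by apply: ns_conj; apply: (group_closedV (ns_closed N)).
Qed.

Lemma quot_mulA : associative quot_mul.
Proof.
elim/quotW=> x; elim/quotW=> y; elim/quotW=> z.
by rewrite (quot_mulE y) (quot_mulE x) (quot_mulE x y) (quot_mulE _ z) mulgA.
Qed.

Lemma quot_mul1g : left_id (\pi_quot_group 1) quot_mul.
Proof. by elim/quotW=> x; rewrite quot_mulE mul1g. Qed.

Lemma quot_mulg1 : right_id (\pi_quot_group 1) quot_mul.
Proof. by elim/quotW=> x; rewrite quot_mulE mulg1. Qed.

Lemma quot_mulVg : left_inverse (\pi_quot_group 1) quot_inv quot_mul.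
Proof. by elim/quotW=> x; rewrite quot_invE quot_mulE mulVg. Qed.

Lemma quot_mulgV : right_inverse (\pi_quot_group 1) quot_inv quot_mul.
Proof. by elim/quotW=> x; rewrite quot_invE quot_mulE mulgV. Qed.

HB.instance Definition _ := isGroup.Build quot_group
  quot_mulA quot_mul1g quot_mulg1 quot_mulVg quot_mulgV.

Lemma quot_piM (x y : T) :
  \pi_quot_group (x * y) = \pi_quot_group x * \pi_quot_group y.
Proof. by rewrite -quot_mulE. Qed.

End QuotientGroup.

Section NilpotentMultiplier.
Variables (F G : groupType) (phi : ghom F G) (c : nat).

(* For R = ker phi: the group R `&` gamma_{c+1}(F), a subgroup of F. *)
Definition mult_num_pred : {pred F} :=
  [predI kerg phi & gamma c.+1].

Lemma mult_num_closed : group_closed mult_num_pred.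
Proof.
have [[R1 RF] [g1 gF]] := (kerg_closed phi, @gamma_closed F c.+1).
split=> [|x y /andP[xR xg] /andP[yR yg]]; first by apply/andP; split.
by apply/andP; split; [apply: RF | apply: gF].
Qed.

Record mult_num := MultNum {
  mult_num_val : F; _ : mult_num_val \in mult_num_pred }.

HB.instance Definition _ := [isSub for mult_num_val].
HB.instance Definition _ := [Choice of mult_num by <:].
HB.instance Definition _ :=
  SubChoice_isSubGroup.Build F mult_num_pred mult_num mult_num_closed.

(* The denominator [R, _c F], seen inside R `&` gamma_{c+1}(F), which         *)
(* contains it (lemma [mult_denS]).                                           *)
Definition mult_den_pred : {pred mult_num} :=
  [pred x | mult_num_val x \in rcomm (kerg phi) predT c].

Lemma mult_den_closed : group_closed mult_den_pred.
Proof.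
have [r1 rF] := @rcomm_closed F (kerg phi) predT c (kerg_closed phi).
split=> [|x y xd yd]; first by rewrite inE (valM _ _, val1).
rewrite inE -[mult_num_val _]/(val _) gmulfF; exact: rF.
Qed.

Lemma mult_den_conj : conj_closed mult_den_pred.
Proof.
move=> x y xd; rewrite inE -[mult_num_val _]/(val _) gmulfJ.
by apply: rcomm_conj => //; apply: kerg_conj.
Qed.

Lemma mult_denS : {subset rcomm (kerg phi) predT c <= mult_num_pred}.
Proof.
move=> x xd; apply/andP; split; last exact: sub_rcomm xd.
elim: c x xd => [|k IH] //= x /asboolP; apply; first exact: kerg_closed.
move=> _ /asboolP[u [v [/IH /eqP uR _ ->]]].
by rewrite inE gmulfR uR comm1g.
Qed.

Definition mult_den := NormalSub mult_den_closed mult_den_conj.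

(* The c-nilpotent multiplier (R `&` gamma_{c+1}(F)) / [R, _c F], as computed *)
(* from the presentation phi; it is M^(c)(G) when F is free and phi is onto.  *)
Definition nil_mult := quot_group mult_den.

HB.instance Definition _ := Group.on nil_mult.

End NilpotentMultiplier.

Section Theta.
Variables (F G Q : groupType) (phi : ghom F G).
Variables (f : ghom G Q) (c : nat).

Lemma kerg_comp : {subset kerg phi <= kerg (f \o phi)}.
Proof. by move=> x /eqP xR; rewrite inE /= xR gmulf1. Qed.

Lemma mult_num_comp :
  {subset mult_num_pred phi c <= mult_num_pred (f \o phi) c}.
Proof.
move=> x /andP[xR xg]; apply/andP; split=> //; exact: kerg_comp.
Qed.

(* With R = ker phi and S = ker (f \o phi), the inclusion of                  *)
(* R `&` gamma_{c+1} into S `&` gamma_{c+1}.                                  *)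
Definition mult_num_incl (x : mult_num phi c) : mult_num (f \o phi) c :=
  MultNum (mult_num_comp (valP x)).

Definition theta (x : nil_mult phi c) : nil_mult (f \o phi) c :=
  \pi_(nil_mult (f \o phi) c) (mult_num_incl (repr x)).

Lemma thetaE (x : mult_num phi c) :
  theta (\pi_(nil_mult phi c) x) =
  \pi_(nil_mult (f \o phi) c) (mult_num_incl x).
Proof.
apply/esym/quot_eqP; have := repr_quot (mult_den phi c) x.
exact: (sub_rcomm kerg_comp).
Qed.

Lemma thetaM : {morph theta : x y / x * y}.
Proof.
elim/quotW=> x; elim/quotW=> y; rewrite -quot_piM !thetaE -quot_piM.
by congr (\pi_(_) _); apply: val_inj.
Qed.

Lemma theta1 : theta 1 = 1.
Proof.
by apply: (@mulgI _ (theta 1)); rewrite -thetaM !mulg1.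
Qed.

HB.instance Definition _ :=
  isMultiplicative.Build (nil_mult phi c) (nil_mult (f \o phi) c) theta thetaM.
HB.instance Definition _ :=
  Multiplicative_isUMagmaMorphism.Build (nil_mult phi c)
    (nil_mult (f \o phi) c) theta theta1.

End Theta.

Arguments theta {F G Q} phi f c x.

Section Abelianization.
Variable G : finGroupType.

(* The projection of G onto G / G'. As G' is normal in G, the type [coset_of] *)
(* is the whole quotient group.                                               *)
Definition abel_proj : G -> coset_of [set: G]^`(1) := coset [set: G]^`(1).

Lemma abel_projM : {morph abel_proj : x y / x * y}.
Proof.
have nG z : z \in 'N([set: G]^`(1)).
  by apply: (subsetP (der_norm 1%N [set: G]%G)); rewrite in_setT.
by move=> x y; rewrite /abel_proj morphM.
Qed.

HB.instance Definition _ :=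
  isMultiplicative.Build G (coset_of [set: G]^`(1)) abel_proj abel_projM.
HB.instance Definition _ :=
  Multiplicative_isUMagmaMorphism.Build G (coset_of [set: G]^`(1))
    abel_proj (morph1 _).

End Abelianization.

Arguments abel_proj G x : clear implicits.

Definition free_on (X : Type) (F : groupType) (b : X -> F) : Prop :=
  forall (H : groupType) (h : X -> H),
    exists psi : ghom F H,
      (forall x, psi (b x) = h x) /\
      (forall psi' : ghom F H,
         (forall x, psi' (b x) = h x) -> psi' =1 psi).

Inductive bracket := Letter of nat | Bracket of bracket & bracket.

Fixpoint bracket_code (u : bracket) : GenTree.tree nat :=
  match u with
  | Letter i => GenTree.Leaf i
  | Bracket u1 u2 => GenTree.Node 0 [:: bracket_code u1; bracket_code u2]
  end.

Fixpoint bracket_decode (t : GenTree.tree nat) : option bracket :=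
  match t with
  | GenTree.Leaf i => Some (Letter i)
  | GenTree.Node _ [:: t1; t2] =>
      if (bracket_decode t1, bracket_decode t2) is (Some u1, Some u2)
      then Some (Bracket u1 u2) else None
  | _ => None
  end.

Lemma bracket_codeK : pcancel bracket_code bracket_decode.
Proof. by elim=> //= u1 -> u2 ->. Qed.

HB.instance Definition _ := Countable.copy bracket (pcan_type bracket_codeK).

Fixpoint weight (u : bracket) : nat :=
  if u is Bracket u1 u2 then weight u1 + weight u2 else 1.

(* [basic_upto d m] lists the basic commutators of weight at most m on the    *)
(* letters 0, ..., d-1. The list is also the order in which they are taken:   *)
(* letters first, then by increasing weight, and arbitrarily (here, as        *)
(* enumerated) within a weight. [Bracket u v] of weight m is basic when u and *)
(* v are basic, v < u and, if u = [u1, u2], u2 <= v.                          *)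
Fixpoint basic_upto (d m : nat) : seq bracket :=
  match m with
  | 0 => [::]
  | 1 => [seq Letter i | i <- iota 0 d]
  | m'.+1 =>
      let L := basic_upto d m' in
      let lt_ v u := index v L < index u L in
      let le_ v u := index v L <= index u L in
      L ++ [seq w <- [seq Bracket u v | u <- L, v <- L] |
              (weight w == m) &&
              (if w is Bracket u v then
                 lt_ v u && (if u is Bracket _ u2 then le_ u2 v else true)
               else false)]
  end%N.

(* The number of basic commutators of weight m on d letters (it is known to   *)
(* be given by Witt's formula).                                               *)
Definition chi (m d : nat) : nat :=
  count (fun w => weight w == m) (basic_upto d m).

(* Main.v *)
From HB Require Import structures.
From mathcomp Require Import generic_quotient.
Require Import Defs.
From mathcomp Require Import boolp classical_sets cardinality.
From mathcomp Require Import all_boot all_fingroup all_solvable.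

Import GroupScope.
Local Open Scope card_scope.
Local Open Scope quotient_scope.

Set Implicit Arguments.
Unset Strict Implicit.
Unset Printing Implicit Defensive.

(** The hypothesis forces G to be elementary abelian ([max_nil_mult_abelem]).
    Then G' = 1, so theta is induced by the identity of F and both conclusions
    are immediate.

    Write R for the kernel of phi and M_c(U) = [U, F, .., F] with c copies of
    F. As M^(c)(G) lies in gamma_(c+1)(F) / M_c(R), it suffices to bound the
    index of M_c(R) in gamma_(c+1)(F). Suppose that G is not elementary
    abelian, let p^d be the order of G / Phi(G) and p^k > 1 that of Phi(G), so
    that n = d + k, and refine Phi(G) by normal subgroups of G to a series with
    factors of order p. Its preimages in F give a chain from the preimage of
    Phi(G) down to R. A factor M_c(U) / M_c(V) of the corresponding chain
    from gamma_(c+1)(F) to M_c(R) is central of exponent p, and multilinear in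
    U / V and c elements of F modulo R.

    Each factor is bounded by Hall's theorem that basic commutators span the
    Lie ring of a filtered group ([basic_span_pair]). Take n letters, the first
    d standing for generators of G and one further letter for each step of the
    series. The top factor is spanned by the basic commutators of weight c+1
    in the first d letters ([index_top_layer]), and the factor of a given step
    by those with exactly one further letter, the one of that step
    ([index_layer]). These families are disjoint, so the index is at most
    p^chi(c+1, n), and it is smaller if some basic commutator of weight c+1
    has two further letters. If c > 1 or k > 1 there is one, which contradicts
    the hypothesis.

    There remains c = k = 1. If G were not abelian, the cosets outside R would
    make the index exceed the order of M(G). If G is abelian, some generator y
    has y^p <> 1, and y^p generates the subgroup Phi(G) of order p. Choosing
    y^p for the further letter z makes the basic commutator [z, y] trivial, so
    that again one of the chi(2, n) factors p is lost. *)

(** * Commutators modulo a normal subgroup *)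

Section CommutatorIdentities.
Variable F : groupType.
Implicit Types x y z : F.

(* Two words that are equal in the free group have the same normal form once  *)
(* products are associated to the left and adjacent inverses cancelled.       *)
Local Ltac group_words :=
  rewrite !commgEl !conjgE ?(invgM, invgK, mulgA);
  rewrite ?(mulgK, mulgKV, mulVg, mulgV, mul1g) //.

Lemma conjg_mul_comm x y : x ^ y = x * [~ x, y].
Proof. by group_words. Qed.

Lemma comm_mull x y z : [~ x * y, z] = [~ x, z] ^ y * [~ y, z].
Proof. by group_words. Qed.

Lemma comm_mulr x y z : [~ x, y * z] = [~ x, z] * [~ x, y] ^ z.
Proof. by group_words. Qed.

Lemma comm_invl x y : [~ x^-1, y] = ([~ x, y]^-1) ^ x^-1.
Proof. by group_words. Qed.

Lemma comm_invr x y : [~ x, y^-1] = ([~ x, y]^-1) ^ y^-1.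
Proof. by group_words. Qed.

Lemma Hall_Witt x y z :
  [~ x, y^-1, z] ^ y * [~ y, z^-1, x] ^ z * [~ z, x^-1, y] ^ x = 1.
Proof. by group_words. Qed.

End CommutatorIdentities.

Section NormalSubgroups.
Variable F : groupType.
Implicit Types (x y z : F) (A K U V : {pred F}).

Definition normal_pred A := group_closed A /\ conj_closed A.

Section Theory.
Variable K : {pred F}.
Hypothesis nK : normal_pred K.

Lemma normal_pred1 : 1 \in K. Proof. by case: nK => -[]. Qed.

Lemma normal_predM x y : x \in K -> y \in K -> x * y \in K.
Proof. exact: (group_closedM nK.1). Qed.

Lemma normal_predV x : x \in K -> x^-1 \in K.
Proof. exact: (group_closedV nK.1). Qed.

Lemma normal_predJ x y : (x ^ y \in K) = (x \in K).
Proof.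
by apply/idP/idP=> [xyK|]; [rewrite -(conjgK y x)|]; apply: nK.2.
Qed.

Lemma normal_predVr x : (x^-1 \in K) = (x \in K).
Proof. by apply/idP/idP=> /normal_predV; rewrite ?invgK. Qed.

Lemma normal_predMl x y : y \in K -> (x * y \in K) = (x \in K).
Proof.
move=> yK; apply/idP/idP=> [xyK|xK]; last exact: normal_predM.
by rewrite -(mulgK y x); apply: normal_predM => //; apply: normal_predV.
Qed.

Lemma comm_mem_l x y : x \in K -> [~ x, y] \in K.
Proof.
move=> xK; rewrite commgEl; apply: normal_predM; first by rewrite normal_predVr.
by rewrite normal_predJ.
Qed.

Lemma commVl x y : ([~ x^-1, y] \in K) = ([~ x, y] \in K).
Proof. by rewrite comm_invl normal_predJ normal_predVr. Qed.

Lemma commVr x y : ([~ x, y^-1] \in K) = ([~ x, y] \in K).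
Proof. by rewrite comm_invr normal_predJ normal_predVr. Qed.

Lemma commC x y : ([~ x, y] \in K) = ([~ y, x] \in K).
Proof. by rewrite -normal_predVr invgR. Qed.

Lemma comm_closed_l y : group_closed [pred x | [~ x, y] \in K].
Proof.
split=> [|u v]; rewrite !inE; first by rewrite comm1g normal_pred1.
by move=> uK vK; rewrite comm_mull normal_predM ?normal_predJ // commVl.
Qed.

Lemma comm_closed_r x : group_closed [pred y | [~ x, y] \in K].
Proof.
split=> [|u v]; rewrite !inE; first by rewrite commg1 normal_pred1.
by move=> uK vK; rewrite comm_mulr normal_predM ?normal_predJ // commVr.
Qed.

(** The three subgroups principle for elements: by the Hall-Witt identity, a
    normal subgroup with two of the three commutators has the third. *)
Lemma comm3_mem x y z :
  [~ [~ y^-1, z^-1], x] \in K -> [~ [~ z, x^-1], y^-1] \in K ->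
  [~ [~ x, y], z] \in K.
Proof.
move=> yzx zxy; have := normal_pred1; rewrite -(Hall_Witt x y^-1 z) invgK.
by rewrite normal_predMl ?normal_predJ // normal_predMl ?normal_predJ.
Qed.

(** Turns congruences modulo K into equations, so that powers of commuting
    elements can be handled by rewriting. *)
Lemma quotient_morphism :
  exists (Q : groupType) (pi : ghom F Q), forall x, (pi x == 1) = (x \in K).
Proof.
pose N := NormalSub nK.1 nK.2; pose pi x : quot_group N := \pi_(quot_group N) x.
have piM : {morph pi : x y / x * y} by move=> x y; apply: quot_piM.
have pi1 : pi 1 = 1 by apply: (@mulgI _ (pi 1)); rewrite -piM !mulg1.
pose m1 := isMultiplicative.Build F (quot_group N) pi piM.
pose m2 := Multiplicative_isUMagmaMorphism.Build F (quot_group N) pi pi1.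
pose pih : ghom F (quot_group N) := HB.pack pi m1 m2.
exists (quot_group N), pih => x; rewrite -[pih x]/(pi x) -pi1 eq_sym.
apply/eqP/idP=> [/(@quot_eqP _ N)|xK]; first by rewrite invg1 mul1g.
by apply/(@quot_eqP _ N); rewrite invg1 mul1g.
Qed.

Lemma expM_mod m x y : [~ x, y] \in K ->
  x ^+ m \in K -> y ^+ m \in K -> (x * y) ^+ m \in K.
Proof.
have [Q [pi kerpi]] := quotient_morphism; rewrite -!kerpi.
rewrite gmulfR !gmulfXn gmulfM => /commgP cxy xm ym.
by rewrite expgMn // (eqP xm) (eqP ym) mulg1.
Qed.

Lemma commX_mod m x y : [~ [~ x, y], x] \in K ->
  [~ x ^+ m, y] \in K -> [~ x, y] ^+ m \in K.
Proof.
have [Q [pi kerpi]] := quotient_morphism; rewrite -!kerpi.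
rewrite !(gmulfR, gmulfXn) => /commgP cxy; rewrite commgEl conjXg.
by rewrite conjg_mul_comm expgMn ?mulKg //; apply: commute_sym.
Qed.

End Theory.

(** * The series M_b = [U, F, .., F] below a normal subgroup U *)

Lemma normal_pred_full : normal_pred (@predT F).
Proof. by []. Qed.

Lemma rcomm_normal U b : normal_pred U -> normal_pred (rcomm U predT b).
Proof.
by case=> clU cjU; split; [apply: rcomm_closed | apply: rcomm_conj].
Qed.

Lemma rcomm_comm U b x y :
  x \in rcomm U predT b -> [~ x, y] \in rcomm U predT b.+1.
Proof.
move=> xU; rewrite -[rcomm _ _ _]/(gen _); apply: Defs.mem_gen.
by apply/asboolP; exists x, y.
Qed.

Lemma rcomm_ind U b T : group_closed T ->
  (forall x y, x \in rcomm U predT b -> [~ x, y] \in T) ->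
  {subset rcomm U predT b.+1 <= T}.
Proof.
move=> clT UT x /asboolP; apply=> // _ /asboolP[u [v [uU _ ->]]].
exact: UT.
Qed.

Lemma rcomm_shift U V b : group_closed V ->
  (forall x y, x \in U -> [~ x, y] \in V) ->
  {subset rcomm U predT b.+1 <= rcomm V predT b}.
Proof.
move=> clV UV; rewrite /rcomm iterSr; apply: sub_rcomm.
exact: (@rcomm_ind U 0).
Qed.

(** Induction on a by the three subgroups principle: bracketing with [u, v] is
    bracketing with u and v in succession, in both orders. *)
Lemma rcomm_gamma V a b x y : normal_pred V ->
  x \in rcomm V predT b -> y \in rcomm predT predT a ->
  [~ x, y] \in rcomm V predT (a + b).+1.
Proof.
move=> nV; elim: a b x y => [|a IH] b x y xV yF; first exact: rcomm_comm.
have nK := rcomm_normal (a.+1 + b).+1 nV.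
pose T := [pred y | [~ x, y] \in rcomm V predT (a.+1 + b).+1].
apply: (@rcomm_ind _ a T _ _ y yF) => [|u v uF]; first exact: comm_closed_r.
rewrite inE (commC nK); apply: (comm3_mem nK).
  rewrite addSnnS; apply: IH => //.
  rewrite -(normal_predVr (rcomm_normal _ nV)) invgR.
  by apply: rcomm_comm; rewrite (normal_predVr (rcomm_normal _ nV)).
rewrite addSn; apply: rcomm_comm; apply: IH => //.
by rewrite (normal_predVr (rcomm_normal _ normal_pred_full)).
Qed.

(** By induction on b: [x, y]^m is congruent to [x^m, y], and the commutators
    that generate [U, _b F] commute modulo [V, _b F]. *)
Lemma rcomm_exp U V m b x : normal_pred U -> normal_pred V ->
  (forall u y, u \in U -> [~ u, y] \in V) ->
  (forall u, u \in U -> u ^+ m \in V) ->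
  x \in rcomm U predT b -> x ^+ m \in rcomm V predT b.
Proof.
move=> nU nV UV Um; elim: b x => [|b IH] x; first exact: Um.
have nMU c := rcomm_normal c nU; have nMV c := rcomm_normal c nV.
have UVb c := @rcomm_shift U V c nV.1 UV.
pose T := [predI rcomm U predT b.+1 & [pred x | x ^+ m \in rcomm V predT b.+1]].
suff sT : {subset rcomm U predT b.+1 <= T} by move=> /sT/andP[].
apply: rcomm_ind => [|u y uU].
  split=> [|u v /andP[uU um] /andP[vU vm]].
    rewrite inE; apply/andP; split; first exact: normal_pred1.
    by rewrite inE expg1n normal_pred1.
  rewrite inE; apply/andP; split; first by rewrite normal_predM ?normal_predVr.
  rewrite inE; apply: (expM_mod (nMV _)) => //.
    by apply/UVb/rcomm_comm.
  by rewrite expVgn normal_predVr.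
rewrite inE; apply/andP; split; first exact: rcomm_comm.
rewrite inE; apply: (commX_mod (nMV _)).
  by apply/UVb/rcomm_comm/rcomm_comm.
by apply: rcomm_comm; apply: IH.
Qed.

End NormalSubgroups.

(** * The order of the basic commutators *)

Section BasicCommutators.
Variable d : nat.
Implicit Types (u v w : bracket) (m : nat).
Local Notation L := (basic_upto d).

(** The condition for [u, v] to be basic once u and v are, in the order of the
    list s. *)
Definition basic_pair (s : seq bracket) u v :=
  ((index v s < index u s) &&
   (if u is Bracket _ u2 then index u2 s <= index v s else true))%N.

Lemma weight_gt0 u : (0 < weight u)%N.
Proof. by elim: u => //= u1 lt1 u2 _; rewrite addn_gt0 lt1. Qed.

Lemma basic_uptoS m : L m.+2 = L m.+1 ++
  [seq w <- [seq Bracket u v | u <- L m.+1, v <- L m.+1] |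
    (weight w == m.+2) && (if w is Bracket u v then basic_pair (L m.+1) u v
                           else false)].
Proof. by []. Qed.

Lemma mem_letter i m : (0 < m)%N -> (i < d)%N -> Letter i \in L m.
Proof.
case: m => // m _ lt_id; elim: m => [|m IH].
  by apply: map_f; rewrite mem_iota.
by rewrite basic_uptoS mem_cat IH.
Qed.

(** Lists for larger weights extend those for smaller ones at the end, so the
    order of two basic commutators can be compared in any list. *)
Lemma basic_upto_cat m k :
  exists2 s, L (m + k) = L m ++ s & all (fun w => m < weight w)%N s.
Proof.
elim: k => [|k [s def_s lt_s]]; first by exists [::]; rewrite ?addn0 ?cats0.
case: m def_s lt_s => [|m] def_s lt_s.
  exists (L k.+1); rewrite ?add0n //; apply/allP=> w _; exact: weight_gt0.
rewrite addnS [(m.+1 + k)%N]addSn basic_uptoS -addSn def_s -catA.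
eexists; first by [].
rewrite all_cat lt_s /=; apply/allP=> w; rewrite mem_filter.
by case/andP=> /andP[/eqP-> _] _; rewrite !ltnS leq_addr.
Qed.

Lemma basic_uptoP m k : (m <= k)%N ->
  exists2 s, L k = L m ++ s & all (fun w => m < weight w)%N s.
Proof. by move/subnKC <-; apply: basic_upto_cat. Qed.

Lemma weight_basic m u : u \in L m -> (weight u <= m)%N.
Proof.
case: m => [|m] //; elim: m => [|m IH]; first by case/mapP=> i _ ->.
rewrite basic_uptoS mem_cat mem_filter => /orP[/IH/leqW //|].
by case/andP=> /andP[/eqP-> _].
Qed.

Lemma basic_upto_mono m k u : (m <= k)%N -> u \in L m -> u \in L k.
Proof. by case/basic_uptoP=> s -> _ um; rewrite mem_cat um. Qed.

Lemma basic_upto_le m k u : u \in L m -> (weight u <= k)%N -> u \in L k.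
Proof.
move=> um le_uk; case: (leqP m k) => [/basic_upto_mono-> //|/ltnW le_km].
have [s def_m lt_s] := basic_uptoP le_km; move: um; rewrite def_m mem_cat.
by case/orP=> // /(allP lt_s); rewrite ltnNge le_uk.
Qed.

Lemma index_basic m k u : (m <= k)%N -> u \in L m ->
  index u (L k) = index u (L m).
Proof. by case/basic_uptoP=> s -> _ um; rewrite index_cat um. Qed.

Lemma index_lt_weight m u v : u \in L m -> v \in L m ->
  (weight u < weight v)%N -> (index u (L m) < index v (L m))%N.
Proof.
move=> um vm lt_uv; have le_um := weight_basic um.
have uu := basic_upto_le um (leqnn _).
have [s -> _] := basic_uptoP le_um; rewrite !index_cat uu ifN.
  by rewrite (leq_trans _ (leq_addr _ _)) // index_mem.
by apply/negP=> /weight_basic; rewrite leqNgt lt_uv.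
Qed.

Lemma basic_bracket_mem m u v :
  Bracket u v \in L m ->
  [/\ u \in L m, v \in L m & basic_pair (L m) u v].
Proof.
case: m => // m; elim: m u v => [|m IH] u v; first by case/mapP.
have le_m : (m.+1 <= m.+2)%N by [].
have old w : w \in L m.+1 -> index w (L m.+2) = index w (L m.+1).
  exact: index_basic.
have up w : w \in L m.+1 -> w \in L m.+2 by apply: basic_upto_mono.
have in_pair : u \in L m.+1 -> v \in L m.+1 ->
    basic_pair (L m.+1) u v -> basic_pair (L m.+2) u v.
  move=> uL vL; rewrite /basic_pair !old //.
  by case: u uL => // u1 u2 /IH[_ u2L _]; rewrite old.
rewrite basic_uptoS mem_cat mem_filter -basic_uptoS => /orP[/IH[uL vL uv]|].
  by split; [exact: up | exact: up | exact: in_pair].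
case/andP=> /andP[_ uv] /allpairsP[[u' v'] /= [uL vL []]].
move=> eu ev; rewrite -{}eu -{}ev {u' v'} in uL vL.
by split; [exact: up | exact: up | exact: in_pair].
Qed.

Lemma mem_basic_bracket m u v : (weight u + weight v <= m)%N ->
  u \in L m -> v \in L m -> basic_pair (L m) u v -> Bracket u v \in L m.
Proof.
move=> le_m uL vL uv; apply: (basic_upto_mono le_m).
have [lt_u lt_v] := (weight_gt0 u, weight_gt0 v).
case def_k: (weight u + weight v)%N => [|[|k]].
- by move: def_k lt_u; case: (weight u).
- by move: def_k lt_u lt_v; case: (weight u) (weight v) => [|[|i]] [|j].
have le_k: (k.+1 <= m)%N by rewrite (leq_trans _ le_m) // def_k.
have uk : u \in L k.+1.
  apply: basic_upto_le uL _; rewrite -ltnS -def_k.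
  by rewrite -[X in (X < _)%N]addn0 ltn_add2l.
have vk : v \in L k.+1.
  apply: basic_upto_le vL _; rewrite -ltnS -def_k.
  by rewrite -[X in (X < _)%N]add0n ltn_add2r.
rewrite basic_uptoS mem_cat mem_filter /= def_k eqxx /= allpairs_f //.
rewrite andbT; apply/orP; right.
move: uv; rewrite /basic_pair !(index_basic le_k) //.
case: u {uL lt_u def_k le_m} uk => // u1 u2 /basic_bracket_mem[_ u2k _].
by rewrite (index_basic le_k).
Qed.

End BasicCommutators.

(** * Basic commutators span *)

Fixpoint eval_bracket (F : groupType) (e : nat -> F) (w : bracket) : F :=
  match w with
  | Letter i => e i
  | Bracket u v => [~ eval_bracket e u, eval_bracket e v]
  end.

Fixpoint count_letters (P : pred nat) (w : bracket) : nat :=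
  match w with
  | Letter i => P i
  | Bracket u v => (count_letters P u + count_letters P v)%N
  end.

Section HallSpanning.
Variable F : groupType.
Implicit Types (x y z : F) (A B : nat -> nat -> {pred F}).

(** The quotients A i j / B i j are the components of a Lie ring graded by
    pairs (i, j), the bracket being induced by commutators. The first degree is
    the weight and the second counts the letters of a distinguished kind. *)
Record lie_series A B := LieSeries {
  ls_normal : forall i j, normal_pred (A i j);
  ls_normal_low : forall i j, normal_pred (B i j);
  ls_sub : forall i j, {subset B i j <= A i j};
  ls_central : forall i j x y, x \in A i j -> [~ x, y] \in B i j;
  ls_comm : forall i j i' j' x y, (0 < i)%N -> (0 < i')%N ->
    x \in A i j -> y \in A i' j' -> [~ x, y] \in A (i + i')%N (j + j')%N;
  ls_comm_low : forall i j i' j' x y, (0 < i)%N -> (0 < i')%N ->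
    x \in B i j -> y \in A i' j' -> [~ x, y] \in B (i + i')%N (j + j')%N }.

Variables (A B : nat -> nat -> {pred F}) (lsAB : lie_series A B).
Variables (d m : nat) (P : pred nat) (e : nat -> F).
Hypothesis e_in : forall i, e i \in A 1 (P i).

Local Notation L := (basic_upto d m).
Local Notation E := (eval_bracket e).
Local Notation deg := (count_letters P).

(** The subgroup of F whose image in A i j / B i j is the additive span of the
    basic commutators of degree (i, j). *)
Definition basic_span i j : {pred F} := gen [pred x | `[< x \in B i j \/
  exists w, [/\ w \in L, weight w = i, deg w = j & x = E w] >]].

Lemma eval_bracket_in w : E w \in A (weight w) (deg w).
Proof.
by elim: w => [i|u IHu v IHv] //=; apply: (ls_comm lsAB); rewrite ?weight_gt0.
Qed.

Lemma basic_span_low i j : {subset B i j <= basic_span i j}.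
Proof. by move=> x xB; apply: Defs.mem_gen; apply/asboolP; left. Qed.

Lemma basic_span_mem i j w :
  w \in L -> weight w = i -> deg w = j -> E w \in basic_span i j.
Proof.
by move=> wL wi wj; apply: Defs.mem_gen; apply/asboolP; right; exists w.
Qed.

Lemma basic_span_ind i j (T : {pred F}) : group_closed T ->
  {subset B i j <= T} ->
  (forall w, w \in L -> weight w = i -> deg w = j -> E w \in T) ->
  {subset basic_span i j <= T}.
Proof.
move=> clT BT ET x /asboolP; apply=> // y /asboolP[/BT //|].
by case=> w [wL wi wj ->]; apply: ET.
Qed.

Lemma basic_span_sub i j : {subset basic_span i j <= A i j}.
Proof.
apply: basic_span_ind (ls_normal lsAB i j).1 (@ls_sub _ _ lsAB i j) _.
by move=> w _ <- <-; apply: eval_bracket_in.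
Qed.

Lemma basic_span_normal i j : normal_pred (basic_span i j).
Proof.
split=> [|x y xS]; first exact: gen_closed.
rewrite conjg_mul_comm; apply: (group_closedM (@gen_closed _ _)) => //.
by apply: basic_span_low; apply: (ls_central lsAB); apply: basic_span_sub.
Qed.

(** The spans are normal, so the x with [x, y] in a span form a subgroup, and it
    suffices to test x on generators. *)
Lemma basic_span_comm i j i' j' y : (0 < i)%N -> (0 < i')%N -> y \in A i' j' ->
  (forall w, w \in L -> weight w = i -> deg w = j ->
     [~ E w, y] \in basic_span (i + i') (j + j')) ->
  forall x, x \in basic_span i j -> [~ x, y] \in basic_span (i + i') (j + j').
Proof.
move=> i_gt0 i'_gt0 yA Ey.
pose T := [pred x | [~ x, y] \in basic_span (i + i') (j + j')].
apply: (@basic_span_ind i j T) => //.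
  exact: comm_closed_l (basic_span_normal _ _) _.
by move=> x xB; apply: basic_span_low; apply: (ls_comm_low lsAB).
Qed.

(** Hall's rewriting. If [u, v] is not basic although u > v, then u = [u1, u2]
    with u2 > v, and the Jacobi identity replaces [u, v] by [[u1, v], u2] and
    [u1, [u2, v]]. Expanding the inner brackets, of smaller weight, gives
    brackets of basic commutators that both exceed v, so a descending
    induction on the lower entry of the pair terminates. *)
Lemma basic_span_pair u v :
  u \in L -> v \in L -> (weight u + weight v <= m)%N ->
  [~ E u, E v] \in basic_span (weight u + weight v) (deg u + deg v).
Proof.
have nS := basic_span_normal.
have [k le_k] := ubnP (weight u + weight v)%N.
elim: k => // k IHk in u v le_k * => uL vL le_m.
have [h le_h] := ubnP (size L - minn (index u L) (index v L))%N.
elim: h => // h IHh in u v le_k le_h uL vL le_m *.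
wlog lt_vu : u v le_k le_h uL vL le_m / (index v L < index u L)%N.
  move=> hyp; case: (ltngtP (index v L) (index u L)); first exact: hyp.
    move=> lt_uv.
    rewrite (commC (nS _ _)) [(weight u + _)%N]addnC [(deg u + _)%N]addnC.
    by apply: hyp => //; rewrite 1?addnC 1?minnC.
  move/(congr1 (nth u L)); rewrite !nth_index // => ->.
  by rewrite commgg (normal_pred1 (nS _ _)).
have [uv_basic | uv_nonbasic] := boolP (basic_pair L u v).
  by rewrite -[[~ _, _]]/(E (Bracket u v)) basic_span_mem ?mem_basic_bracket.
case: u => [i|u1 u2] in le_k le_h uL le_m lt_vu uv_nonbasic *.
  by rewrite /basic_pair lt_vu in uv_nonbasic.
rewrite /basic_pair lt_vu /= -ltnNge in uv_nonbasic.
have [u1L u2L /andP[lt_u21 _]] := basic_bracket_mem uL.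
have [[w1 w2] wv] := (weight_gt0 u1, weight_gt0 u2, weight_gt0 v).
have lt_vL : (index v L < size L)%N by rewrite index_mem.
rewrite (minn_idPr (ltnW lt_vu)) in le_h; rewrite /= in le_k le_m |- *.
(* Here y is a combination of basic commutators of the weight of [b, v], all  *)
(* larger than v. Both [u1, [u2, v]] and [[u1, v], u2] have this form.        *)
pose wt_uv := (weight u1 + weight u2 + weight v)%N.
have step a b y : (weight b + weight v + weight a)%N = wt_uv ->
    a \in L -> b \in L -> (index v L < index a L)%N ->
    y \in basic_span (weight b + weight v) (deg b + deg v) ->
    [~ y, E a] \in basic_span (weight b + weight v + weight a)
                              (deg b + deg v + deg a).
  rewrite /wt_uv => def_w aL bL lt_va; have wa := weight_gt0 a.
  apply: basic_span_comm => //; first by rewrite addn_gt0 wv orbT.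
    exact: eval_bracket_in.
  move=> w wL w_wt <-; rewrite -w_wt; apply: IHh => //.
  - by rewrite w_wt def_w.
  - rewrite -ltnS (leq_trans _ le_h) // ltnS ltn_sub2l //.
    rewrite leq_min lt_va andbT index_lt_weight // w_wt.
    by rewrite -[X in (X < _)%N]add0n ltn_add2r weight_gt0.
  by rewrite w_wt def_w.
have lt_pair a b : (0 < weight a)%N ->
    (weight b + weight v + weight a)%N = wt_uv ->
  (weight b + weight v < k)%N /\ (weight b + weight v <= m)%N.
  rewrite /wt_uv => wa def_w; split.
    rewrite -ltnS (leq_trans _ le_k) // ltnS -def_w.
    by rewrite -[X in (X < _)%N]addn0 ltn_add2l.
  by rewrite (leq_trans _ le_m) // -def_w leq_addr.
have def1 : (weight u2 + weight v + weight u1)%N = wt_uv.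
  by rewrite addnC addnA.
have def2 : (weight u1 + weight v + weight u2)%N = wt_uv by rewrite addnAC.
apply: (comm3_mem (nS _ _)).
  rewrite -/wt_uv -def1.
  have ->: (deg u1 + deg u2 + deg v = deg u2 + deg v + deg u1)%N.
    by rewrite [RHS]addnC addnA.
  have [lt2 le2] := lt_pair u1 u2 w1 def1.
  apply: step => //; first exact: leq_trans uv_nonbasic (ltnW lt_u21).
  by rewrite (commVl (nS _ _)) (commVr (nS _ _)) IHk.
rewrite (commVr (nS _ _)) -/wt_uv -def2 [(deg u1 + _ + _)%N]addnAC.
have [lt1 le1] := lt_pair u2 u1 w2 def2.
apply: step => //.
by rewrite (commVr (nS _ _)) (commC (nS _ _)) IHk.
Qed.

End HallSpanning.

Section SpanOfLayer.
Variables (F : groupType) (A B : nat -> nat -> {pred F}).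
Hypothesis lsAB : lie_series A B.
Variables (d m : nat) (P : pred nat) (e : nat -> F).
Hypothesis e_in : forall i, e i \in A 1 (P i).
Local Notation span := (basic_span B d m P e).

(** Elements of [U, _b F] are sums of commutators [x, y] with y in F.
    Linearity in y reduces to letters of second degree 0, linearity in x to a
    pair formed by a basic commutator and such a letter. *)
Lemma rcomm_basic_span (U R : {pred F}) j b :
  {subset U <= span 1 j} ->
  (forall a x y, x \in rcomm U predT a -> y \in R -> [~ x, y] \in B a.+2 j) ->
  (forall H, group_closed H -> (forall i, (i < d)%N -> ~~ P i -> e i \in H) ->
     {subset R <= H} -> forall x, x \in H) ->
  (b < m)%N -> {subset rcomm U predT b <= span b.+1 j}.
Proof.
move=> U1 RB genF; elim: b => [_ //|b IH lt_bm].
have nS i k : normal_pred (span i k) by exact: (basic_span_normal lsAB).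
apply: rcomm_ind => [|x y xU]; first exact: (nS _ _).1.
pose T := [pred y | [~ x, y] \in span b.+2 j].
apply: (genF T); first exact: comm_closed_r (nS _ _) _.
  move=> i lt_id Pi; rewrite inE.
  suff: [~ x, e i] \in span (b.+1 + 1) (j + P i).
    by rewrite (negPf Pi) addn0 addn1.
  apply: (basic_span_comm lsAB e_in) => //; last exact: IH (ltnW lt_bm) _ _.
  move=> w wL wt_w <-; rewrite -[e i]/(eval_bracket e (Letter i)).
  rewrite -wt_w; apply: (basic_span_pair lsAB e_in) => //.
    by rewrite mem_letter // (leq_trans _ lt_bm).
  by rewrite wt_w addn1.
by move=> z zR; rewrite inE; apply: basic_span_low; apply: RB.
Qed.

End SpanOfLayer.

(** * Counting cosets *)

Section Index.
Variable F : groupType.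
Implicit Types (x y : F) (K M N : {pred F}).

(** For subgroups K <= N of a possibly infinite group this says that the index
    of K in N is at most k. *)
Definition index_le N K (k : nat) := exists2 s : seq F, (size s <= k)%N &
  forall x, x \in N -> exists2 h, h \in s & h^-1 * x \in K.

Lemma index_le_trans N M K a b :
  index_le N M a -> index_le M K b -> index_le N K (a * b)%N.
Proof.
case=> s le_s sN [t le_t tM]; exists [seq h * g | h <- s, g <- t].
  by rewrite size_allpairs leq_mul.
move=> x /sN[h hs /tM[g gt hgx]]; exists (h * g); first exact: allpairs_f.
by rewrite invgM -mulgA.
Qed.

Lemma index_le_weaken N K K' k k' : {subset K <= K'} -> (k <= k')%N ->
  index_le N K k -> index_le N K' k'.
Proof.
move=> KK' le_k [s le_s sK]; exists s; first exact: leq_trans le_k.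
by move=> x /sK[h hs /KK' hx]; exists h.
Qed.

Lemma index_le_refl K : group_closed K -> index_le K K 1.
Proof.
by move=> clK; exists [:: 1] => // x xK; exists 1; rewrite ?inE // invg1 mul1g.
Qed.

(** Modulo K the generators are central of exponent p, so the products of their
    powers with exponents below p represent all cosets. *)
Lemma index_le_exp N K p (s : seq F) : (0 < p)%N -> normal_pred K ->
  (forall x y, x \in s -> [~ x, y] \in K) ->
  (forall x, x \in s -> x ^+ p \in K) ->
  {subset N <= gen [pred x | (x \in s) || (x \in K)]} ->
  index_le N K (p ^ size s).
Proof.
move=> p_gt0 nK sK sp NS.
suff [t le_t tS] :
    index_le (gen [pred x | (x \in s) || (x \in K)]) K (p ^ size s).
  by exists t => // x /NS/tS.
elim: s sK sp {N NS} => [|a s IH] sK sp.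
  have [t le_t tK] := index_le_refl nK.1; exists t => // x /asboolP xK.
  by apply: tK; apply: xK => [|y]; [case: nK | rewrite inE].
pose M := gen [pred x | (x \in s) || (x \in K)].
have KM x : x \in K -> x \in M.
  by move=> xK; apply: Defs.mem_gen; rewrite inE xK orbT.
have nM : normal_pred M.
  split=> [|x y xM]; first exact: gen_closed.
  rewrite conjg_mul_comm; apply: (group_closedM (@gen_closed _ _)) => //.
  apply: KM; pose T := [pred x | [~ x, y] \in K].
  suff: x \in T by [].
  move/asboolP: xM; apply; first exact: comm_closed_l.
  move=> z /orP[zs|zK]; rewrite inE; last exact: comm_mem_l.
  by apply: sK; rewrite inE zs orbT.
have {}IH : index_le M K (p ^ size s).
  by apply: IH => [x y xs|x xs]; [apply: sK | apply: sp]; rewrite inE xs orbT.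
rewrite expnS; apply: index_le_trans IH.
exists [seq a ^+ i | i <- iota 0 p]; first by rewrite size_map size_iota.
have [Q [pi kerpi]] := quotient_morphism nM.
have pia : pi a ^+ p = 1.
  by apply/eqP; rewrite -gmulfXn kerpi; apply/KM/sp/mem_head.
move=> x; pose T := [pred x | `[< exists i, pi x = pi a ^+ i >]].
move=> /asboolP xT; have /asboolP[i pix] : x \in T.
  apply: xT => [|y /orP[]].
  - split=> [|y z /asboolP[i piy] /asboolP[j piz]]; apply/asboolP.
      by exists 0%N; rewrite gmulf1.
    exists (i + p.-1 * j)%N; rewrite gmulfF piy piz expgnDr; congr (_ * _).
    apply: (mulIg (pi a ^+ j)); rewrite mulVg -expgnDr -mulSnr prednK //.
    by rewrite expgnA pia expg1n.
  - rewrite inE => /orP[/eqP->|ys]; apply/asboolP; first by exists 1%N.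
    exists 0%N; apply/eqP; rewrite kerpi; apply: Defs.mem_gen.
    by rewrite inE ys.
  by move=> yK; apply/asboolP; exists 0%N; apply/eqP; rewrite kerpi KM.
exists (a ^+ (i %% p)); first by rewrite map_f // mem_iota ltn_mod.
rewrite -kerpi gmulfM gmulfV gmulfXn pix {2}(divn_eq i p) expgnDr mulnC.
by rewrite expgnA pia expg1n mul1g mulVg.
Qed.

End Index.

Section SpanIndex.
Variables (F : groupType) (A B : nat -> nat -> {pred F}).
Hypothesis lsAB : lie_series A B.
Variables (d m : nat) (P : pred nat) (e : nat -> F).
Hypothesis e_in : forall i, e i \in A 1 (P i).

(** Basic commutators of trivial value are left out of the count: this is what
    separates the contributions of the different steps of a series. *)
Lemma index_le_basic_span (N : {pred F}) p i j : (0 < p)%N ->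
  (forall x, x \in A i j -> x ^+ p \in B i j) ->
  {subset N <= basic_span B d m P e i j} ->
  index_le N (B i j)
    (p ^ count (fun w => [&& weight w == i, count_letters P w == j
                           & eval_bracket e w != 1]) (basic_upto d m)).
Proof.
move=> p_gt0 Ap NS; set Q := (X in count X _).
pose s := [seq eval_bracket e w | w <- basic_upto d m & Q w].
have sA x : x \in s -> x \in A i j.
  case/mapP=> w; rewrite mem_filter => /andP[/and3P[/eqP<- /eqP<- _] _] ->.
  exact: (eval_bracket_in lsAB e_in).
have -> : count Q (basic_upto d m) = size s by rewrite size_map size_filter.
apply: index_le_exp => // [|x y /sA|x /sA|x /NS].
- exact: (ls_normal_low lsAB).
- exact: (ls_central lsAB).
- exact: Ap.
move/asboolP; apply; first exact: gen_closed.
move=> y /asboolP yS; apply: Defs.mem_gen; rewrite inE.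
case: yS => [->|[w [wL wi wj ->]]]; first by rewrite orbT.
have [->|Ew] := eqVneq (eval_bracket e w) 1.
  by rewrite (normal_pred1 (ls_normal_low lsAB i j)) orbT.
by rewrite map_f // mem_filter /Q wi wj !eqxx Ew.
Qed.

End SpanIndex.

(** * The Lie ring of a layer V <= U *)

Section Layers.

Local Arguments rcomm : simpl never.
Variable F : groupType.
Implicit Types (x y : F) (U V W : {pred F}).

(** Second degree 0 and 1 stand for the two series built on U0 and U1; from 2
    on everything is F, which makes the graded components trivial. *)
Definition layers U0 U1 (i j : nat) : {pred F} :=
  match j with
  | 0 => rcomm U0 predT i.-1
  | 1 => rcomm U1 predT i.-1
  | _ => predT
  end.

(** The components of second degree 0 form the Lie ring of gamma_i(F) modulo
    [W, F, .., F], and those of degree 1 the module U / V makes of it. *)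
Lemma layers_lie_series W U V :
  normal_pred W -> normal_pred U -> normal_pred V -> {subset V <= U} ->
  (forall x y, [~ x, y] \in W) -> (forall x y, x \in U -> [~ x, y] \in V) ->
  (forall a b x y, x \in rcomm W predT a -> y \in rcomm U predT b ->
     [~ x, y] \in rcomm V predT (a + b).+1) ->
  lie_series (layers predT U) (layers W V).
Proof.
move=> nW nU nV VU FW UV WU; have nF := normal_pred_full F.
have nc (A : {pred F}) b : normal_pred A -> normal_pred (rcomm A predT b).
  exact: rcomm_normal.
split.
- by move=> i [|[|j]] /=; [apply: nc | apply: nc | ].
- by move=> i [|[|j]] /=; [apply: nc | apply: nc | ].
- by move=> i [|[|j]] x //=; apply: sub_rcomm.
- move=> i [|[|j]] x y //= xA.
    apply: (@rcomm_shift _ predT) => [|u v _|]; [exact: nW.1 | by [] |].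
    exact: rcomm_comm.
  by apply: (@rcomm_shift _ U) => //; [exact: nV.1 | exact: rcomm_comm].
- move=> [|i] j [|i'] j' x y // _ _; rewrite addSn addnS /=.
  case: j j' => [|[|j]] [|[|j']] //= xA yA.
  + by rewrite addnC; apply: rcomm_gamma.
  + by rewrite (commC (nc _ _ nU)); apply: rcomm_gamma.
  by rewrite addnC; apply: rcomm_gamma.
move=> [|i] j [|i'] j' x y // _ _; rewrite addSn addnS /=.
case: j j' => [|[|j]] [|[|j']] //= xA yA.
- by rewrite addnC; apply: rcomm_gamma.
- exact: WU.
by rewrite addnC; apply: rcomm_gamma.
Qed.

End Layers.

Lemma count_letters_sub (P Q R : pred nat) w :
  (forall i, P i -> Q i || R i) ->
  (count_letters P w <= count_letters Q w + count_letters R w)%N.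
Proof.
move=> PQR; elim: w => [i|u IHu v IHv] /=.
  by case: (P i) (PQR i) => // /(_ isT); case: (Q i) (R i) => -[].
by rewrite addnACA leq_add.
Qed.

Lemma eval_bracket_eq1 (F : groupType) (e : nat -> F) (Q : pred nat) w :
  (forall i, Q i -> e i = 1) -> (0 < count_letters Q w)%N ->
  eval_bracket e w = 1.
Proof.
move=> Qe; elim: w => [i|u IHu v IHv] /=; first by case: (Q i) (Qe i) => // ->.
by rewrite addn_gt0 => /orP[/IHu-> | /IHv->]; rewrite ?comm1g ?commg1.
Qed.

(** * Finite p-groups *)

Section FinitePGroups.
Variables (p : nat) (G : finGroupType).
Hypotheses (p_pr : prime p) (pG : p.-group [set: G]).

Lemma chief_factor (Z : {group G}) j : Z <| [set: G] -> #|Z| = (p ^ j.+1)%N ->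
  exists Z' : {group G}, [/\ Z' \subset Z, Z' <| [set: G], #|Z'| = (p ^ j)%N,
    forall x y, x \in Z -> [~ x, y] \in Z' &
    forall x, x \in Z -> x ^+ p \in Z'].
Proof.
move=> nZ oZ; have le_j : (j <= logn p #|Z|)%N by rewrite oZ pfactorK // ltnW.
have [Z' [sZ'Z nZ' oZ']] := normal_pgroup pG nZ le_j.
have nZ'G := normal_norm nZ'; have nZ'Z := subset_trans (normal_sub nZ) nZ'G.
have oQ : #|Z / Z'| = p.
  rewrite card_quotient // -divgS // oZ oZ' expnS mulnK //.
  by rewrite expn_gt0 prime_gt0.
exists Z'; split=> // [x y xZ | x xZ].
  have cQ : Z / Z' \subset 'C([set: G] / Z').
    have: Z / Z' \subset 'Z([set: G] / Z').
      apply: prime_meetG; first by rewrite oQ.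
      apply: meet_center_nil; last by rewrite -cardG_gt1 oQ prime_gt1.
        by rewrite quotient_nil ?(pgroup_nil pG).
      exact: quotient_normal.
    by move/subset_trans; apply; apply: subsetIr.
  rewrite quotient_cents2 // in cQ.
  by apply: (subsetP cQ); rewrite mem_commg ?inE.
have xN : x \in 'N(Z') by apply: (subsetP nZ'Z).
apply: coset_idr; first by rewrite groupX.
by rewrite morphX // -oQ; apply/expg_cardG/mem_quotient.
Qed.

Lemma chief_factor_gen (Z Z' : {group G}) z j :
  Z' \subset Z -> #|Z| = (p ^ j.+1)%N -> #|Z'| = (p ^ j)%N ->
  z \in Z -> z \notin Z' -> Z \subset <<z |: Z'>>.
Proof.
move=> sZ'Z oZ oZ' zZ zZ'.
have /maxgroupP[_ maxZ'] : maximal Z' Z.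
  apply: p_index_maximal => //; rewrite -divgS // oZ oZ' expnS mulnK //.
  by rewrite expn_gt0 prime_gt0.
apply: contraNT zZ' => nsZ.
have sZ : <<z |: Z'>> \subset Z by rewrite gen_subG subUset sub1set zZ.
have <- : <<z |: Z'>> = Z'.
  apply: (maxZ' <<z |: Z'>>%G); first by rewrite properE sZ.
  exact: subset_trans (subsetUr _ _) (subset_gen _).
by rewrite /= mem_gen // setU11.
Qed.

(** The easy half of the Burnside basis theorem: representatives of a basis of
    G / Phi(G) generate G. *)
Lemma burnside_basis k d : #|'Phi([set: G])| = (p ^ k)%N ->
  #|G| = (p ^ (k + d))%N ->
  exists2 s : seq G, size s = d & <<[set x in s]>> = [set: G].
Proof.
move=> oPhi oG; set Phi := 'Phi(_) in oPhi.
have nPhi : [set: G] \subset 'N(Phi) by apply/normal_norm/Phi_normal.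
have oQ : #|[set: G] / Phi| = (p ^ d)%N.
  rewrite card_quotient // -divgS ?Phi_sub // cardsT oG oPhi expnD mulKn //.
  by rewrite expn_gt0 prime_gt0.
have abQ : p.-abelem ([set: G] / Phi) by apply: Phi_quotient_abelem.
have [S defS oS] := grank_witness ([set: G] / Phi).
exists [seq repr x | x : coset_of Phi in S].
  rewrite size_map -cardE oS grank_abelian ?(abelem_abelian abQ) //.
  by rewrite (rank_abelem abQ) oQ pfactorK.
apply: Phi_nongen; apply/eqP; rewrite eqEsubset subsetT /=.
set X := [set x in _]; have: Phi * <<X>> \subset Phi <*> X.
  by rewrite mul_subG ?joing_subl // genS ?subsetUr.
apply: subset_trans.
rewrite -quotientSK // -defS gen_subG; apply/subsetP=> x xS.
rewrite -[x]coset_reprK mem_quotient // mem_gen // inE.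
by apply/mapP; exists x; rewrite ?mem_enum.
Qed.

End FinitePGroups.

(** * The order of gamma_(c+1)(F) modulo [R, _c F] *)

Section MultiplierBound.
Variables (p : nat) (G : finGroupType) (F : groupType) (phi : ghom F G).
Hypotheses (p_pr : prime p) (pG : p.-group [set: G]).
Hypothesis phi_onto : forall g, exists x, phi x = g.
Variables (c n d : nat) (s : seq F).
Hypotheses (le_dn : (d <= n)%N) (sz_s : size s = d).
Hypothesis gen_s : <<[set g in map phi s]>> = [set: G].

Local Arguments rcomm : simpl never.
Local Notation R := (kerg phi).
Local Notation L := (basic_upto n c.+1).
Local Notation extra := (fun i => d <= i)%N.
Local Notation pre Z := [pred x | phi x \in (gval Z)].

Lemma preim_normal (Z : {group G}) : Z <| [set: G] -> normal_pred (pre Z).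
Proof.
move=> nZ; split=> [|x y]; first split=> [|x y]; rewrite ?inE ?gmulf1 //.
  by rewrite gmulfF => xZ yZ; rewrite groupM ?groupV.
by rewrite gmulfJ memJ_norm // (subsetP (normal_norm nZ)) ?inE.
Qed.

Lemma preim_gen (A : {set G}) (H : {pred F}) :
  group_closed H -> {subset R <= H} ->
  (forall g, g \in A -> exists2 x, x \in H & phi x = g) ->
  forall x, phi x \in <<A>> -> x \in H.
Proof.
move=> clH RH AH x; pose T := [set g | `[< exists2 y, y \in H & phi y = g >]].
have gT : group_set T.
  apply/group_setP; split=> [|g h]; rewrite !inE.
    by apply/asboolP; exists 1; rewrite ?gmulf1 //; case: clH.
  move=> /asboolP[y yH <-] /asboolP[z zH <-]; apply/asboolP; exists (y * z).
    exact: group_closedM.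
  by rewrite gmulfM.
have sAT : <<A>> \subset Group gT.
  by rewrite gen_subG; apply/subsetP=> g /AH yg; rewrite inE; apply/asboolP.
move/(subsetP sAT); rewrite inE => /asboolP[y yH def_y].
rewrite -(mulKVg y x); apply: group_closedM => //; apply: RH.
by rewrite inE gmulfM gmulfV def_y mulVg.
Qed.

(** Trivial values for the letters of the other steps kill the basic commutators
    that belong to those steps. *)
Definition letters i0 (r : F) i :=
  if (i < d)%N then nth 1 s i else if i == i0 then r else 1.

Lemma letters_generate i0 r (H : {pred F}) : group_closed H ->
  (forall i, (i < n)%N -> ~~ extra i -> letters i0 r i \in H) ->
  {subset R <= H} -> forall x, x \in H.
Proof.
move=> clH lH RH x; apply: (@preim_gen [set g in map phi s]) => //; last first.
  by rewrite gen_s inE.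
move=> g; rewrite inE => /mapP[y ys ->]; exists y => //.
have lt_yd : (index y s < d)%N by rewrite -sz_s index_mem.
have := lH (index y s); rewrite /letters lt_yd nth_index // -ltnNge; apply=> //.
exact: leq_trans lt_yd le_dn.
Qed.

Definition layer_count i0 r k := count (fun w => [&& weight w == c.+1,
  count_letters extra w == k & eval_bracket (letters i0 r) w != 1]) L.

(** This is the factor with U = F: as F modulo the preimage of Phi(G) is
    elementary abelian and spanned by the d generators, no further letter is
    needed. *)
Lemma index_top_layer : index_le (rcomm predT predT c)
  (rcomm (pre 'Phi([set: G])%G) predT c) (p ^ layer_count d 1 0).
Proof.
set Phi := 'Phi(_)%G; have p_gt0 := prime_gt0 p_pr.
have nF := normal_pred_full F.
have nW : normal_pred (pre Phi) by apply/preim_normal/Phi_normal.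
have defPhi : Phi :=: _ := Phi_joing pG.
have WF x y : [~ x, y] \in pre Phi.
  rewrite inE gmulfR defPhi mem_gen // inE derg1 mem_commg ?inE //.
have Wp x : x ^+ p \in pre Phi.
  rewrite inE gmulfXn defPhi mem_gen // inE; apply/orP; right.
  by rewrite -[p]expn1 Mho_p_elt ?(mem_p_elt pG) ?inE.
have RW x : x \in R -> x \in pre Phi by rewrite !inE => /eqP->.
have lsF : lie_series (layers (@predT F) predT) (layers (pre Phi) predT).
  apply: layers_lie_series => // a b x y xW yF; rewrite addnC.
  by apply: rcomm_gamma => //; apply: sub_rcomm xW.
have e_in i : letters d 1 i \in layers (@predT F) predT 1 (extra i).
  by case: (extra i).
apply: (index_le_basic_span lsF e_in (i := c.+1) (j := 0%N)) => //.
  by move=> x /= xF; apply: rcomm_exp xF => // u _; apply: Wp.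
apply: (rcomm_basic_span lsF e_in (R := R)) => //.
- move=> x _.
  apply: (@letters_generate d 1) => [|i lt_in Pi|y yR].
  + exact: (basic_span_normal lsF _ _ e_in _ _).1.
  + rewrite -[letters d 1 i]/(eval_bracket (letters d 1) (Letter i)).
    apply: basic_span_mem => //; first exact: mem_letter.
    by rewrite /= (negPf Pi).
  by apply: basic_span_low; apply: RW.
- move=> a x y xF yR /=.
  have nM : normal_pred (rcomm (pre Phi) predT a.+1) by apply: rcomm_normal.
  rewrite (commC nM); rewrite -[a.+1]addn0 addSn.
  apply: (@rcomm_gamma _ _ a 0) => //.
  exact: RW.
exact: letters_generate.
Qed.

(** U / V is generated by the class of r and is central in F / V, so M_c(U) is
    spanned modulo M_c(V) by basic commutators in which r occurs once. *)
Lemma index_layer (Z Z' : {group G}) i0 r :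
  Z' \subset Z -> Z <| [set: G] -> Z' <| [set: G] ->
  (forall x y, x \in Z -> [~ x, y] \in Z') ->
  (forall x, x \in Z -> x ^+ p \in Z') ->
  phi r \in Z -> Z \subset <<phi r |: Z'>> -> (d <= i0 < n)%N ->
  index_le (rcomm (pre Z) predT c) (rcomm (pre Z') predT c)
           (p ^ layer_count i0 r 1%N).
Proof.
move=> sZ'Z nZ nZ' ZZ' Zp Zr genZ /andP[le_di lt_in].
have [nU nV] := (preim_normal nZ, preim_normal nZ').
have p_gt0 := prime_gt0 p_pr; have nF := normal_pred_full F.
have nW := rcomm_normal 1 nF.
have VU : {subset pre Z' <= pre Z} by move=> x; apply: (subsetP sZ'Z).
have UV x y : x \in pre Z -> [~ x, y] \in pre Z'.
  by rewrite !inE gmulfR; apply: ZZ'.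
have UVb b := @rcomm_shift _ _ _ b nV.1 UV.
have RV x : x \in R -> x \in pre Z' by rewrite !inE => /eqP->.
have lsF : lie_series (layers predT (pre Z))
                      (layers (rcomm predT predT 1) (pre Z')).
  apply: layers_lie_series => // [x y|a b x y xW yU]; first exact: rcomm_comm.
  rewrite (commC (rcomm_normal _ nV)); apply: UVb.
  have := @rcomm_gamma _ (pre Z) a.+1 b y x nU yU; apply.
  by rewrite /rcomm iterSr.
have e_in i : letters i0 r i \in layers predT (pre Z) 1 (extra i).
  rewrite /letters; have [lt_id|le_di'] := ltnP i d; first by [].
  by rewrite /= inE; case: eqP => _; rewrite ?gmulf1.
apply: (index_le_basic_span lsF e_in (i := c.+1) (j := 1%N)) => //.
  move=> x /= xU; apply: rcomm_exp xU => // u; rewrite !inE gmulfXn.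
  exact: Zp.
apply: (rcomm_basic_span lsF e_in (R := R)) => //.
- pose S := basic_span (layers (rcomm predT predT 1) (pre Z')) n c.+1
    extra (letters i0 r) 1 1.
  have VS x : x \in pre Z' -> x \in S by move=> xV; apply: basic_span_low.
  move=> x xU; apply: (@preim_gen (phi r |: Z')) (subsetP genZ _ xU) => //.
  + exact: (basic_span_normal lsF _ _ e_in _ _).1.
  + by move=> y /RV/VS.
  move=> g /setU1P[->|gZ']; last first.
    have [y def_y] := phi_onto g; exists y => //.
    by apply: VS; rewrite inE def_y.
  exists r => //.
  rewrite -/S; have -> : r = eval_bracket (letters i0 r) (Letter i0).
    by rewrite /= /letters ltnNge le_di eqxx.
  by apply: basic_span_mem => //; [apply: mem_letter | rewrite /= le_di].
- move=> a x y xU yR /=.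
  have nM : normal_pred (rcomm (pre Z') predT a.+1) by apply: rcomm_normal.
  rewrite (commC nM) -[a.+1]addn0 addSn.
  apply: (@rcomm_gamma _ _ a 0) => //; first exact: RV.
  exact: sub_rcomm xU.
exact: letters_generate.
Qed.

Lemma letters_surviving j r w : count_letters extra w = 1%N ->
  eval_bracket (letters (d + j) r) w != 1 ->
  count_letters (fun i => d + j.+1 <= i)%N w = 0%N /\
  count_letters (fun i => d + j <= i)%N w != 0%N.
Proof.
move=> w1 Ew; have trivial_letters (Q : pred nat) :
    (forall i, Q i -> (d <= i)%N && (i != d + j)%N) -> count_letters Q w = 0%N.
  move=> Qd; apply/eqP; apply: contraNT Ew; rewrite -lt0n => Qw.
  apply/eqP; apply: eval_bracket_eq1 Qw => i /Qd/andP[le_di /negPf ne_ij].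
  by rewrite /letters ltnNge le_di ne_ij.
split.
  apply: trivial_letters => i; rewrite addnS ltn_neqAle => /andP[ne_i le_i].
  by rewrite eq_sym ne_i (leq_trans (leq_addr j d)).
apply/eqP=> w0; pose Q i := (d <= i)%N && (i != d + j)%N.
have := @count_letters_sub extra Q (fun i => d + j <= i)%N w.
rewrite w1 w0 (trivial_letters Q) //= => imp; suff: (1 <= 0)%N by [].
by apply: imp => i le_di; rewrite /Q le_di /=; case: eqP => [->|?] /=.
Qed.

(** With the letter d + j as i0, the surviving basic commutators use exactly
    one letter beyond the generators, namely d + j: the counts for different j
    are those of disjoint families. *)
Lemma index_chain j (Z : {group G}) : Z <| [set: G] -> #|Z| = (p ^ j)%N ->
  (d + j <= n)%N -> index_le (rcomm (pre Z) predT c) (rcomm R predT c)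
    (p ^ count (fun w => [&& weight w == c.+1, count_letters extra w == 1%N
                & count_letters (fun i => d + j <= i)%N w == 0%N]) L).
Proof.
elim: j Z => [|j IH] Z nZ oZ le_jn.
  have := index_le_refl (rcomm_normal c (preim_normal nZ)).1.
  apply: index_le_weaken; last by rewrite expn_gt0 prime_gt0.
  by apply: sub_rcomm => x; rewrite !inE (card1_trivg oZ) inE.
have [Z' [sZ'Z nZ' oZ' ZZ' Zp]] := chief_factor p_pr pG nZ oZ.
have [z zZ zZ'] : exists2 z, z \in Z & z \notin Z'.
  apply/subsetPn; apply: contraTN (leqnn #|Z|) => /subset_leq_card le_ZZ'.
  by rewrite -ltnNge (leq_ltn_trans le_ZZ') // oZ oZ' ltn_exp2l ?prime_gt1.
have [r def_r] := phi_onto z.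
have genZ := chief_factor_gen p_pr sZ'Z oZ oZ' zZ zZ'.
rewrite -def_r in zZ genZ.
have i0P : (d <= d + j < n)%N by rewrite leq_addr -addnS.
have lt_jn : (d + j <= n)%N by case/andP: i0P => _ /ltnW.
have := index_le_trans (index_layer sZ'Z nZ nZ' ZZ' Zp zZ genZ i0P)
                       (IH Z' nZ' oZ' lt_jn).
rewrite -expnD; apply: index_le_weaken => //.
rewrite leq_exp2l ?prime_gt1 // /layer_count -count_predUI.
rewrite [X in (_ + X)%N](@eq_count _ _ pred0) ?count_pred0 ?addn0; last first.
  move=> w /=; apply/negP=> /andP[/and3P[_ /eqP w1 Ew] /and3P[_ _ w0]].
  by have [_] := letters_surviving w1 Ew; rewrite w0.
apply: sub_count => w /orP[] /and3P[-> /eqP w1].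
  by case/(letters_surviving w1)=> -> _; rewrite w1.
rewrite w1 -!leqn0 => le_w0 /=; apply: leq_trans le_w0.
have w0 : count_letters pred0 w = 0%N by elim: w {w1} => //= u -> v ->.
rewrite -[X in (_ <= X)%N]addn0 -[X in (_ <= _ + X)%N]w0.
by apply: count_letters_sub => i; rewrite addnS => /ltnW->.
Qed.

End MultiplierBound.

(** * Omitted basic commutators and the size of the multiplier *)

Section OmittedCommutators.
Variables (d m : nat).
Local Notation L := (basic_upto d m).

Lemma index_letter i : (0 < m)%N -> (i < d)%N -> index (Letter i) L = i.
Proof.
move=> m_gt0 lt_id; rewrite (@index_basic d 1 m) ?mem_letter //=.
rewrite index_map => [|? ? []//]; rewrite -{1}[i](@nth_iota 0%N 0%N d) //.
by rewrite index_uniq ?size_iota ?iota_uniq.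
Qed.

Lemma mem_bracket_letters i j : (1 < m)%N -> (i < j < d)%N ->
  Bracket (Letter j) (Letter i) \in L.
Proof.
move=> m_gt1 /andP[lt_ij lt_jd]; have m_gt0 := ltnW m_gt1.
have lt_id := ltn_trans lt_ij lt_jd.
by rewrite mem_basic_bracket ?mem_letter // /basic_pair !index_letter // lt_ij.
Qed.

(** The left-normed commutator [z, x, .., x] for x = Letter 0. *)
Fixpoint left_normed z k :=
  if k is k'.+1 then Bracket (left_normed z k') (Letter 0) else Letter z.

Lemma weight_left_normed z k : weight (left_normed z k) = k.+1.
Proof. by elim: k => //= k ->; rewrite addn1. Qed.

Lemma mem_left_normed z k : (0 < z < d)%N -> (k < m)%N ->
  left_normed z k \in L.
Proof.
move=> /andP[z_gt0 lt_zd]; have d_gt0 := leq_ltn_trans (leq0n z) lt_zd.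
elim: k => [|k IH] lt_km; first exact: mem_letter.
have uL := IH (ltnW lt_km); have m_gt0 := leq_trans (ltn0Sn _) lt_km.
have xL : Letter 0 \in L by apply: mem_letter.
apply: mem_basic_bracket => //=; first by rewrite weight_left_normed addn1.
case: k {IH lt_km} uL => [|k] uL; rewrite /basic_pair /=.
  by rewrite !index_letter // z_gt0.
by rewrite leqnn andbT index_lt_weight //= addn1 weight_left_normed.
Qed.

Lemma mem_left_normed_bracket z k : (0 < z < d)%N -> (0 < k)%N ->
  (k.+1 < m)%N -> Bracket (left_normed z k) (Letter z) \in L.
Proof.
move=> z0d k_gt0 lt_km; have uL := mem_left_normed z0d (ltnW lt_km).
have m_gt0 := leq_trans (ltn0Sn _) lt_km; case/andP: (z0d) => z_gt0 lt_zd.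
have d_gt0 := leq_ltn_trans (leq0n z) lt_zd.
have zL : Letter z \in L by apply: mem_letter.
apply: mem_basic_bracket => //=; first by rewrite weight_left_normed addn1.
case: k k_gt0 {lt_km} uL => // k _ uL; rewrite /basic_pair.
by rewrite index_lt_weight //= ?index_letter // addn1 weight_left_normed.
Qed.

End OmittedCommutators.

(** Pigeonhole: elements of N that are distinct modulo K are at most as many as
    the coset representatives. *)
Lemma index_le_size (F : groupType) (N K : {pred F}) k (T : eqType) (t : seq T)
    (x : T -> F) : normal_pred K -> index_le N K k -> uniq t ->
  (forall i, i \in t -> x i \in N) ->
  (forall i j, i \in t -> j \in t -> (x i)^-1 * x j \in K -> i = j) ->
  (size t <= k)%N.
Proof.
move=> nK [s le_s sN] uniq_t xN x_inj; apply: leq_trans le_s.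
have [h hP] : {h : T -> F &
    forall i, i \in t -> h i \in s /\ (h i)^-1 * x i \in K}.
  apply: (@choice _ _ (fun i y => i \in t -> y \in s /\ y^-1 * x i \in K)) => i.
  by have [/xN/sN[y]|_] := boolP (i \in t); [exists y | exists 1].
rewrite -(size_map h); apply: uniq_leq_size => [|_ /mapP[i /hP[? _] ->] //].
rewrite map_inj_in_uniq // => i j it jt eq_h; apply: x_inj => //.
have [[_ hi] [_ hj]] := (hP i it, hP j jt).
have -> : (x i)^-1 * x j = ((h i)^-1 * x i)^-1 * ((h i)^-1 * x j).
  by rewrite invgM invgK !mulgA mulgK.
by rewrite (normal_predM nK) ?(normal_predVr nK) // eq_h.
Qed.

(** * The multiplier of a p-group that is not elementary abelian *)

Section Multiplier.
Variables (F G : groupType) (phi : ghom F G) (c M : nat).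
Hypothesis size_mult : [set: nil_mult phi c]%classic #= `I_M.

Let R := rcomm (kerg phi) predT c.

Lemma rcomm_ker_normal : normal_pred R.
Proof.
by apply: rcomm_normal; split; [apply: kerg_closed | apply: kerg_conj].
Qed.

Lemma mult_representatives : exists x : nat -> F,
  (forall i, (i < M)%N -> x i \in gamma c.+1 /\ phi (x i) = 1) /\
  (forall i j, (i < M)%N -> (j < M)%N -> (x i)^-1 * x j \in R -> i = j).
Proof.
have /card_set_bijP[f [_ _ f_surj]] := size_mult.
have [y fy] : {y : nat -> nil_mult phi c & forall i, (i < M)%N -> f (y i) = i}.
  apply: (@choice _ _ (fun i y => (i < M)%N -> f y = i)) => i.
  have [lt_iM|_] := ltnP i M; last by exists 1.
  by have [y _ <-] := f_surj i lt_iM; exists y.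
exists (fun i => val (generic_quotient.repr (y i))).
split=> [i _|i j lti ltj xij].
  by have /andP[/eqP] := valP (generic_quotient.repr (y i)).
rewrite -(fy i lti) -(fy j ltj) -(reprK (y i)) -(reprK (y j)); congr f.
apply/(@quot_eqP _ (mult_den phi c)); rewrite inE.
by rewrite -[mult_num_val _]/(val _) gmulfM gmulfV.
Qed.

Lemma nil_mult_le k : index_le (gamma c.+1) R k -> (M <= k)%N.
Proof.
have [x [xN x_inj]] := mult_representatives => Rk.
rewrite -(size_iota 0 M); apply: (index_le_size rcomm_ker_normal Rk (x := x)).
- exact: iota_uniq.
- by move=> i; rewrite mem_iota => /xN[].
by move=> i j; rewrite !mem_iota; apply: x_inj.
Qed.

(** The multiplier counts the cosets of R inside the kernel of phi only, and g
    lies in a coset outside. *)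
Lemma nil_mult_lt k g : index_le (gamma c.+1) R k ->
  g \in gamma c.+1 -> phi g != 1 -> (M < k)%N.
Proof.
have [x [xN x_inj]] := mult_representatives => Rk gN g1.
have RK y : y \in R -> phi y = 1.
  by move/mult_denS => /andP[/eqP].
pose x' i := if i == M then g else x i.
rewrite -(size_iota 0 M.+1).
apply: (index_le_size rcomm_ker_normal Rk (x := x')); first exact: iota_uniq.
  move=> i; rewrite mem_iota ltnS /x' /= => le_iM; case: eqP => // /eqP ne_iM.
  by have [] := xN i; rewrite // ltn_neqAle ne_iM.
move=> i j; rewrite !mem_iota !ltnS /x' /= => le_iM le_jM.
have lt i0 : (i0 <= M)%N -> i0 != M -> (i0 < M)%N.
  by rewrite ltn_neqAle => -> ->.
have [-> | ne_i] := eqVneq i M; have [-> // | ne_j] := eqVneq j M.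
- move/RK; rewrite gmulfM gmulfV (xN j (lt j _ _)).2 // mulg1 => /eqP.
  by rewrite invg_eq1 (negPf g1).
- move/RK; rewrite gmulfM gmulfV (xN i (lt i _ _)).2 // invg1 mul1g => /eqP.
  by rewrite (negPf g1).
by apply: x_inj; apply: lt.
Qed.

End Multiplier.

(** The bound and its two ways of being strict: a basic commutator with two
    letters from d on, or, for c = 1 and Phi(G) of order p, a choice of the
    last letter that trivializes a basic commutator. *)
Lemma max_nil_mult_abelem p c n (G : finGroupType) (F : groupType)
    (phi : ghom F G) :
  prime p -> (0 < c)%N -> #|G| = (p ^ n)%N ->
  (forall g : G, exists x : F, phi x = g) ->
  [set: nil_mult phi c]%classic #= `I_(p ^ chi c.+1 n)%N ->
  p.-abelem [set: G].
Proof.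
move=> p_pr c_gt0 oG phi_onto size_mult; apply: contraT => nab.
have p_gt1 := prime_gt1 p_pr.
have pG : p.-group [set: G] by rewrite /pgroup cardsT oG pnatX pnat_id.
set Phi := 'Phi([set: G])%G.
have nPhi : Phi <| [set: G] by apply: Phi_normal.
have [k oPhi] := p_natP (pgroupS (normal_sub nPhi) pG).
have k_gt0 : (0 < k)%N.
  rewrite lt0n; apply: contraNneq nab => k0; rewrite -(trivg_Phi pG).
  by rewrite -[_ == _]/(Phi :==: 1) trivg_card1 oPhi k0.
have le_kn : (k <= n)%N.
  by rewrite -(leq_exp2l _ _ p_gt1) -oPhi -oG -cardsT subset_leq_card ?subsetT.
pose d := (n - k)%N; have def_n : (k + d)%N = n by rewrite subnKC.
have [|sG sz_sG gen_sG] := @burnside_basis p G p_pr pG k d oPhi.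
  by rewrite def_n.
have [lift liftK] := choice phi_onto.
pose s := map lift sG; have def_sG : map phi s = sG.
  by rewrite -map_comp map_id_in // => g _; apply: liftK.
have sz_s : size s = d by rewrite size_map.
have gen_s : <<[set g in map phi s]>> = [set: G] by rewrite def_sG.
have le_dn : (d <= n)%N by rewrite leq_subr.
have d_gt0 : (0 < d)%N.
  rewrite lt0n -sz_sG; apply: contraNneq nab => /size0nil s0.
  rewrite -gen_sG s0 -[X in <<X>>](_ : set0 = _) ?gen0 ?abelem1 //.
have dkn : (d + k)%N = n by rewrite addnC.
have le_dkn : (d + k <= n)%N by rewrite dkn.
have top := index_top_layer p_pr pG c le_dn sz_s gen_s.
have chain := index_chain p_pr pG phi_onto c le_dn sz_s gen_s nPhi oPhi le_dkn.
set L := basic_upto n c.+1 in chain.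
pose T i := count (fun w => (weight w == c.+1) &&
                            (count_letters (fun j => d <= j)%N w == i)) L.
have le_T0 : (layer_count c n d s d 1 0 <= T 0%N)%N.
  by apply: sub_count => w /and3P[-> ->].
have sum_T : (T 0 + T 1 + T 2 <= chi c.+1 n)%N.
  rewrite /T -count_predUI [X in (_ + X + _)%N](@eq_count _ _ pred0).
    2: by move=> w /=; case: eqP => // _; case: eqP => //= ->.
  rewrite count_pred0 addn0 -count_predUI.
  rewrite [X in (_ + X)%N](@eq_count _ _ pred0) ?count_pred0 ?addn0; last first.
    move=> w /=; case: (weight w == _) => //=.
    by case: (count_letters _ _) => [|[]].
  by apply: sub_count => w /=; case: (weight w == _).
have le_chi e : index_le (gamma c.+1) (rcomm (kerg phi) predT c) (p ^ e) ->
    (chi c.+1 n <= e)%N.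
  by move/(nil_mult_le size_mult); rewrite leq_exp2l.
have no_comm e g : index_le (gamma c.+1) (rcomm (kerg phi) predT c) (p ^ e) ->
    (e <= chi c.+1 n)%N -> g \in gamma c.+1 -> phi g = 1.
  move=> Re le_e gN; apply: contraTeq le_e => /(nil_mult_lt size_mult Re gN).
  by rewrite ltn_exp2l // -ltnNge.
have Re := index_le_trans top chain; rewrite -expnD in Re.
have [double | /norP[]] := boolP ((1 < c) || (1 < k))%N.
  have T2 : (0 < T 2%N)%N.
    have le_d1n : (d < n)%N by rewrite -dkn -[X in (X < _)%N]addn0 ltn_add2l.
    rewrite /T -has_count; apply/hasP.
    (* [z, x, .., x, z] with z = Letter d and x = Letter 0 *)
    case: (ltnP 1 c) double => [c_gt1 _|c_le1 /= k_gt1].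
      exists (Bracket (left_normed d c.-1) (Letter d)).
        apply: mem_left_normed_bracket; first by rewrite d_gt0.
          by rewrite -ltnS prednK.
        by rewrite prednK.
      rewrite /= weight_left_normed prednK // addn1 eqxx leqnn addn1 eqSS /=.
      by elim: c.-1 => [|a IH] /=; rewrite ?leqnn // leqNgt d_gt0 addn0.
    have c1 : c = 1%N by apply/anti_leq; rewrite c_le1.
    exists (Bracket (Letter d.+1) (Letter d)).
      apply: mem_bracket_letters => //; rewrite ltnSn /=.
      by rewrite -dkn -addn1 -[d.+1]addn1 -addnA leq_add2l.
    by rewrite /= c1 leqnSn leqnn.
  have := leq_trans sum_T (le_chi _ Re); rewrite leqNgt => /negP[].
  rewrite -[X in (X < _)%N]addn0 -addnS leq_add //; apply: leq_add => //.
  by apply: sub_count => w /and3P[-> ->].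
rewrite -!leqNgt => c_le1 k_le1.
have c1 : c = 1%N by apply/anti_leq; rewrite c_le1.
have k1 : k = 1%N by apply/anti_leq; rewrite k_le1.
have phi_comm x y : phi [~ x, y] = 1.
  apply: no_comm Re _ _; last by rewrite c1; apply: (@rcomm_comm F predT 0).
  apply: leq_trans sum_T; rewrite -[X in (X <= _)%N]addn0 leq_add //.
  by apply: leq_add => //; apply: sub_count => w /and3P[-> ->].
have abG : abelian [set: G].
  apply/centsP=> g _ h _; apply/commgP.
  by rewrite -(liftK g) -(liftK h) -gmulfR phi_comm.
have [y ys yp1] : exists2 y, y \in s & phi y ^+ p != 1.
  apply/hasP; apply: contraNT nab => /hasPn s_p1; apply/(abelemP p_pr).
  split=> // g _; have [x <-] := phi_onto g; apply/eqP.
  apply: (@preim_gen _ _ phi [set g in map phi s] [pred x | phi x ^+ p == 1]).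
  - split=> [|u v]; rewrite !inE ?gmulf1 ?expg1n // => /eqP up /eqP vp.
    rewrite gmulfF expgMn ?expVgn ?up ?vp ?invg1 ?mulg1 //.
    by apply: (centsP abG); rewrite inE.
  - by move=> u; rewrite !inE => /eqP->; rewrite expg1n.
  - move=> h; rewrite inE => /mapP[u us ->]; exists u => //.
    by have := s_p1 u us; rewrite negbK.
  by rewrite gen_s inE.
(* the value of Letter d that makes its commutator with y trivial *)
pose r := y ^+ p.
have rPhi : phi r \in Phi.
  rewrite /r gmulfXn /= (Phi_joing pG) mem_gen // inE; apply/orP; right.
  by rewrite -[p]expn1 Mho_p_elt ?(mem_p_elt pG) ?inE.
have oPhi1 : #|Phi| = (p ^ 1)%N by rewrite oPhi k1.
have o1 : #|(1%G : {group G})| = (p ^ 0)%N by rewrite cards1.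
have r1 : phi r \notin (1%G : {group G}) by rewrite inE gmulfXn.
have genPhi := chief_factor_gen p_pr (sub1G Phi) oPhi1 o1 rPhi r1.
have lt_dn : (d <= d < n)%N by rewrite leqnn -dkn k1 addn1 /=.
have bottom : index_le (rcomm [pred x | phi x \in Phi] predT c)
    (rcomm (kerg phi) predT c) (p ^ layer_count c n d s d r 1%N).
  have comm1 u v : u \in Phi -> [~ u, v] \in (1%G : {group G}).
    by move=> _; rewrite inE -(liftK u) -(liftK v) -gmulfR phi_comm.
  have exp1 u : u \in Phi -> u ^+ p \in (1%G : {group G}).
    by move=> uPhi; rewrite inE -[p]expn1 -oPhi1 expg_cardG.
  have := index_layer p_pr phi_onto c le_dn sz_s gen_s (sub1G Phi) nPhi
            (normal1 _) comm1 exp1 rPhi genPhi lt_dn.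
  by apply: index_le_weaken => //; apply: sub_rcomm => x; rewrite !inE.
have lt_bottom : (layer_count c n d s d r 1 < T 1%N)%N.
  pose w := Bracket (Letter d) (Letter (index y s)).
  have lt_yd : (index y s < d)%N by rewrite -sz_s index_mem.
  have wL : w \in L.
    by apply: mem_bracket_letters; rewrite ?c1 // lt_yd; case/andP: lt_dn.
  pose Q u := [&& weight u == c.+1, count_letters (fun j => d <= j)%N u == 1%N
                & eval_bracket (letters d s d r) u == 1].
  have Qw : (0 < count Q L)%N.
    rewrite -has_count; apply/hasP; exists w => //.
    rewrite /Q /= c1 leqnn (leqNgt d) lt_yd /= /letters ltnn eqxx lt_yd.
    by rewrite nth_index //; apply/commgP; rewrite /commute /r -expgSr expgS.
  apply: (@leq_trans (layer_count c n d s d r 1 + count Q L)%N).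
    by rewrite -addn1 leq_add2l.
  rewrite -count_predUI [X in (_ + X)%N](@eq_count _ _ pred0); last first.
    move=> u; apply/negP=> /andP[/and3P[_ _ /negPf Eu] /and3P[_ _]].
    by rewrite Eu.
  rewrite count_pred0 addn0; apply: sub_count => u.
  by case/orP=> /and3P[-> ->].
have Rb := index_le_trans top bottom; rewrite -expnD in Rb.
have := leq_trans (leq_trans (leq_addr _ _) sum_T) (le_chi _ Rb).
by rewrite leqNgt -addnS leq_add.
Qed.

Theorem theorem3p8 (p c n : nat) (G : finGroupType) (X : Type) (F : groupType)
    (b : X -> F) (phi : ghom F G) :
  prime p -> (1 <= c)%N -> #|G| = (p ^ n)%N ->
  free_on b -> (forall g : G, exists x : F, phi x = g) ->
  [set: nil_mult phi c]%classic #= `I_(p ^ chi c.+1 n)%N ->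
  (forall y : nil_mult (abel_proj G \o phi) c,
     exists x : nil_mult phi c, theta phi (abel_proj G) c x = y) /\
  (kerg (theta phi (abel_proj G) c) =i pred1 1 -> p.-abelem [set: G]).
Proof.
move=> p_pr c_gt0 oG _ phi_onto size_mult.
have abG := max_nil_mult_abelem p_pr c_gt0 oG phi_onto size_mult; split=> // y.
have G'1 : [set: G]^`(1) = 1.
  by apply: (derG1P (G := [set: G]%G)); apply: abelem_abelian abG.
have ker_eq x : x \in kerg (abel_proj G \o phi) -> x \in kerg phi.
  rewrite !inE /= /abel_proj => /eqP/coset_idr.
  by rewrite /= G'1 norm1 !inE; apply.
elim/quotW: y => y; have /andP[yker ygamma] := valP y.
have ynum : val y \in mult_num_pred phi c.
  by apply/andP; split=> //; apply: ker_eq.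
exists (\pi_(nil_mult phi c) (MultNum ynum)); rewrite thetaE.
by congr (\pi_(_) _); apply: val_inj.
Qed.
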